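(* Let $F^\tau G$ be the twisted group algebra of a locally finite group $G$ over a field $F$ of characteristic $0$. If $F$ is either algebraically closed or real-closed, then every element of $\mathcal{U}(F^\tau G)'$ is a product of two square elements in $\mathcal{U}(F^\tau G)$, i.e. has the form $u^2v^2$ with $u,v\in\mathcal{U}(F^\tau G)$.
   Context: A group is locally finite if each of its finitely generated subgroups is finite. A field $F$ is real-closed if $F$ is not algebraically closed but $F(\sqrt{-1})$ is algebraically closed. A twisted group algebra $F^\tau G$ of a group $G$ over a field $F$ is an associative ring which contains $F$ and has as an $F$-basis the set $\overline{G}=\{\bar x\mid x\in G\}$, a copy of $G$; so each element is uniquely a finite sum $\sum_{x\in G}r_x\bar x$ with $r_x\in F$. Addition is as expected and multiplication is determined by $\bar x\bar y=\tau(x,y)\overline{xy}$ for $x,y\in G$, where $\tau:G\times G\to F\setminus\{0\}$ is the twisting function (it is an associative $F$-algebra, with scalars in $F$ commuting with the $\bar x$). $\mathcal{U}(F^\tau G)$ is the group of invertible elements of $F^\tau G$, and $\mathcal{U}(F^\tau G)'$ is its derived subgroup, i.e. the subgroup generated by all multiplicative commutators $aba^{-1}b^{-1}$ with $a,b\in\mathcal{U}(F^\tau G)$. *)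

(* Defs.v *)
From HB Require Import structures.
From mathcomp Require Import all_boot all_algebra all_field finmap.

Set Implicit Arguments.
Unset Strict Implicit.
Unset Printing Implicit Defensive.

Import GRing.Theory.
Local Open Scope ring_scope.

Inductive generated (G : groupType) (S : G -> Prop) : G -> Prop :=
| generated_mem x : S x -> generated S x
| generated_1 : generated S 1%g
| generated_M x y : generated S x -> generated S y -> generated S (x * y)%g
| generated_V x : generated S x -> generated S (x^-1)%g.

Definition locally_finite (G : groupType) : Prop :=
  forall s : seq G, exists t : seq G,
    forall x, generated (fun y => y \in s) x -> x \in t.

(* The subgroup generated by the commutators a b a^-1 b^-1; [~ a, b] in the
   library is a^-1 b^-1 a b instead. *)
Definition derived (G : groupType) : G -> Prop :=
  generated (fun c : G => exists a b : G, c = (a * b * a^-1 * b^-1)%g).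

Definition algebraically_closed (F : fieldType) : Prop :=
  GRing.closed_field_axiom F.

(* L is F(sqrt(-1)): it is generated over F by a square root of -1. *)
Definition real_closed (F : fieldType) : Prop :=
  ~ algebraically_closed F /\
  exists (L : fieldExtType F) (i : L),
    [/\ i ^+ 2 = -1, <<1; i>>%VS = fullv & algebraically_closed L].

(* The last field says that bar is an F-basis of A: every element of A is a
   finite F-linear combination of the bar x for a unique finitely supported
   family of coefficients (so bar is injective).  The central copy of F in A is
   that of the F-algebra structure, and the cocycle condition on tau follows
   from associativity in A. *)
Record is_twisted_group_algebra (F : fieldType) (G : groupType)
    (tau : G -> G -> F) (A : algType F) (bar : G -> A) : Prop := {
  twist_neq0 : forall x y, tau x y != 0;
  twist_mul : forall x y, bar x * bar y = tau x y *: bar (x * y)%g;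
  twist_basis : forall a : A, exists! r : {fsfun G -> F with 0},
    a = \sum_(x <- finsupp r) r x *: bar x
}.

Record unit_group (R : unitRingType) : Type := UnitGroup {
  unit_val :> R;
  unit_valP : unit_val \is a GRing.unit
}.

Section UnitGroup.
Variable R : unitRingType.

HB.instance Definition _ := [isSub for @unit_val R].
HB.instance Definition _ := [Choice of unit_group R by <:].

Implicit Types u v w : unit_group R.

Definition unit_one : unit_group R := UnitGroup (unitr1 R).

Lemma unit_mul_subproof u v : unit_val u * unit_val v \is a GRing.unit.
Proof. by rewrite unitrMl ?unit_valP. Qed.

Definition unit_mul u v : unit_group R := UnitGroup (unit_mul_subproof u v).

Lemma unit_inv_subproof u : (unit_val u)^-1 \is a GRing.unit.
Proof. by rewrite unitrV unit_valP. Qed.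

Definition unit_inv u : unit_group R := UnitGroup (unit_inv_subproof u).

Lemma unit_mulA : associative unit_mul.
Proof. by move=> u v w; apply/val_inj; rewrite /= mulrA. Qed.

Lemma unit_mul1 : left_id unit_one unit_mul.
Proof. by move=> u; apply/val_inj; rewrite /= mul1r. Qed.

Lemma unit_mulr1 : right_id unit_one unit_mul.
Proof. by move=> u; apply/val_inj; rewrite /= mulr1. Qed.

Lemma unit_mulV : left_inverse unit_one unit_inv unit_mul.
Proof. by move=> u; apply/val_inj; rewrite /= mulVr ?unit_valP. Qed.

Lemma unit_mulrV : right_inverse unit_one unit_inv unit_mul.
Proof. by move=> u; apply/val_inj; rewrite /= mulrV ?unit_valP. Qed.

HB.instance Definition _ := isGroup.Build (unit_group R)
  unit_mulA unit_mul1 unit_mulr1 unit_mulV unit_mulrV.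

End UnitGroup.

(* Main.v *)
(** All computations take place in B = F^tau H for a finite subgroup H of G, a
    finite-dimensional algebra whose regular trace form is nondegenerate
    (|H| is invertible in F).

    A unit w of B factors in F[w] as w = (1 - 2e) p^2 with e idempotent: on the
    local factors of F[w] either w or -w is a square, by Newton iteration from
    the residue field.  If the corner eBe contains J with J^2 = -e, then
    1 - 2e = (1 - e + J)^2 and w is a product of two squares.  When F is
    algebraically closed, J = sqrt(-1) e.

    Let F be real-closed.  Split e = f + g orthogonally with such a J for f and
    with f as large as possible.  If g <> 0, a primitive idempotent h of gBg
    satisfies hBh = F h, since any other corner would contain a square root of
    -h or a nilpotent in the radical of the trace form.  By maximality of f,
    (g - h) B h = 0.  Take determinants on the left ideal Bh, where w acts with
    determinant 1, being a product of commutators: p^2 and 1 - 2f contribute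
    squares, 1 - 2(g - h) acts trivially, and 1 - 2h contributes -1 as hBh is a
    line.  Hence -1 would be a square in F. *)

Require Import Defs.
From HB Require Import structures.
From mathcomp Require Import all_boot all_algebra all_field finmap.
From mathcomp Require Import ring.
From Stdlib Require Import Classical ClassicalEpsilon.

Set Implicit Arguments.
Unset Strict Implicit.
Unset Printing Implicit Defensive.

Import GRing.Theory.
Local Open Scope ring_scope.

(** * Square roots up to sign modulo a polynomial *)

Section PolySquare.
Variable F : fieldType.
Hypothesis two_neq0 : 2 != 0 :> F.
Implicit Types p q r : {poly F}.

(* The Newton step z(1 + (1 - y z^2)/2) squares the error 1 - y z^2. *)
Lemma hensel_inv_sqr r y k :
  r %| 1 - y -> exists z, r ^+ k %| 1 - y * z ^+ 2.
Proof.
move=> ry; elim: k => [|[|k] [z rz]]; first by exists 1; rewrite dvd1p.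
  by exists 1; rewrite expr1n mulr1.
set t := 1 - _ in rz; set h : {poly F} := (2^-1)%:P.
have h2 : 2 * h = 1 by rewrite /h -polyC_natr -polyCM divff.
exists (z * (1 + h * t)).
have -> : 1 - y * (z * (1 + h * t)) ^+ 2 =
          t * t * (2 * h - h ^+ 2 + h ^+ 2 * t).
  have -> : y * (z * (1 + h * t)) ^+ 2 = (1 - t) * (1 + h * t) ^+ 2.
    by rewrite /t; ring.
  have -> : (1 - t) * (1 + h * t) ^+ 2 =
   1 - (t - (2 * h) * t) - t * t * (2 * h - h ^+ 2 + h ^+ 2 * t) by ring.
  by rewrite h2; ring.
apply: dvdp_mulr; apply: (@dvdp_trans _ (r ^+ k.+1 * r ^+ k.+1)).
  by rewrite -exprD dvdp_exp2l // addSn ltnS leq_addl.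
exact: dvdp_mul.
Qed.

Lemma poly_chinese p q a b : coprimep p q ->
  exists c, p %| c - a /\ q %| c - b.
Proof.
case/Bezout_eq1_coprimepP=> -[u v] /= uv.
exists (a * (v * q) + b * (u * p)); split; apply/dvdpP.
  exists (u * (b - a)); rewrite -[X in _ - X]mulr1 -{1}uv; ring.
exists (v * (a - b)); rewrite -[X in _ - X]mulr1 -{1}uv; ring.
Qed.

(** Evaluated at an element annihilated by [q], the two congruences become a factorisation (1 - 2e)
    p^2 of that element, with e idempotent. *)
Definition sqr_up_to_sign q :=
  exists e p, q %| e ^+ 2 - e /\ q %| (1 - 2 * e) * p ^+ 2 - 'X.

(** Both congruences depend only on the witnesses modulo the divisor, so the Chinese remainder
    theorem glues them. *)
Lemma sqr_up_to_signM p q : coprimep p q ->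
  sqr_up_to_sign p -> sqr_up_to_sign q -> sqr_up_to_sign (p * q).
Proof.
move=> cpq [e1 [a1 [he1 ha1]]] [e2 [a2 [he2 ha2]]].
have [e [ep eq]] := poly_chinese e1 e2 cpq.
have [a [ap aq]] := poly_chinese a1 a2 cpq.
have key d e0 a0 : d %| e - e0 -> d %| a - a0 -> d %| e0 ^+ 2 - e0 ->
    d %| (1 - 2 * e0) * a0 ^+ 2 - 'X ->
    (d %| e ^+ 2 - e) /\ (d %| (1 - 2 * e) * a ^+ 2 - 'X).
  move=> /dvdpP[u eu] /dvdpP[v av] h1 h2.
  have -> : e = e0 + u * d by rewrite -eu; ring.
  have -> : a = a0 + v * d by rewrite -av; ring.
  split.
    have -> : (e0 + u * d) ^+ 2 - (e0 + u * d) =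
      (e0 ^+ 2 - e0) + (2 * e0 * u + u * u * d - u) * d by ring.
    by rewrite dvdp_addl // dvdp_mull.
  have -> : (1 - 2 * (e0 + u * d)) * (a0 + v * d) ^+ 2 - 'X =
    (1 - 2 * e0) * a0 ^+ 2 - 'X +
    ((1 - 2 * e0) * (2 * a0 * v + v * v * d)
      - 2 * u * (a0 + v * d) ^+ 2) * d by ring.
  by rewrite dvdp_addl // dvdp_mull.
have [e_p a_p] := key _ _ _ ep ap he1 ha1.
have [e_q a_q] := key _ _ _ eq aq he2 ha2.
by exists e, a; rewrite !Gauss_dvdp // e_p a_p e_q a_q.
Qed.

End PolySquare.

(** * Primary factors and the condition on the field *)

Section FieldCond.
Variable F : fieldType.
Hypothesis two_neq0 : 2 != 0 :> F.
Implicit Types p q r : {poly F}.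

(** Dividing by [r] as long as possible isolates its whole power; the smaller cofactor drives the
    later inductions. *)
Lemma irredp_primary_decomp r q : irreducible_poly r -> q != 0 -> r %| q ->
  exists k q', [/\ q = r ^+ k.+1 * q', coprimep r q' & (size q' < size q)%N].
Proof.
move=> r_irr; have r_neq0 := irredp_neq0 r_irr; have [n] := ubnP (size q).
elim: n q => // n IHn q /ltnSE sz_q q_neq0 /dvdpP[q1 Dq].
have q1_neq0 : q1 != 0 by apply: contraNneq q_neq0 => q10; rewrite Dq q10 mul0r.
have lt_q1q : (size q1 < size q)%N.
  rewrite Dq size_mul // -subn1 -addnBA ?size_poly_gt0 //.
  by rewrite -[X in (X < _)%N]addn0 ltn_add2l subn_gt0; case: r_irr.
have [rq1|co] := boolP (r %| q1); last first.
  by exists 0, q1; rewrite expr1 mulrC irreducible_poly_coprime.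
have [|k [q2 [Dq1 co lt_q2q1]]] := IHn q1 _ q1_neq0 rq1.
  exact: leq_trans sz_q.
exists k.+1, q2; split=> //; last exact: ltn_trans lt_q1q.
by rewrite exprS -mulrA -Dq1 mulrC.
Qed.

(* The residue field F[X]/r is F or contains a square root j of -1. Here and
   above, a sign is encoded as 1 - 2 e with e idempotent, so that signs chosen
   modulo coprime factors can be glued. *)
Definition square_closed_up_to_sign :=
  forall q, (1 < size q)%N -> exists r, [/\ irreducible_poly r, r %| q,
    (exists a, r = 'X - a%:P) \/ (exists j, r %| j ^+ 2 + 1)
    & exists e p, e ^+ 2 = e /\ r %| (1 - 2 * e) * 'X - p ^+ 2].

Lemma sqr_up_to_sign_primary r k e p :
    coprimep r 'X -> e ^+ 2 = e ->
    r %| (1 - 2 * e) * 'X - p ^+ 2 ->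
  sqr_up_to_sign (r ^+ k).
Proof.
move=> /Bezout_eq1_coprimepP[[u y] /= uy] ee rp.
set s := 1 - 2 * e in rp *.
have ss : s * s = 1.
  have -> : s * s = 1 + 4 * (e ^+ 2 - e) by rewrite /s; ring.
  by rewrite ee; ring.
(* Modulo [r], [y] inverts ['X] and [p ^+ 2] equals [s * 'X]; hence this argument is 1 modulo [r],
   as the lifting requires. *)
have [|z rz] := @hensel_inv_sqr _ two_neq0 r (s * 'X * (p * y) ^+ 2) k.
  have [a ra] := dvdpP _ _ rp; have p2 : p ^+ 2 = s * 'X - a * r.
    by rewrite -ra; ring.
  rewrite exprMn p2; have -> : s * 'X * ((s * 'X - a * r) * y ^+ 2) =
    (s * s) * (y * 'X) ^+ 2 - (s * 'X * a * y ^+ 2) * r by ring.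
  rewrite ss; have -> : y * 'X = 1 - u * r by rewrite -uy; ring.
  apply/dvdpP; exists (s * 'X * a * y ^+ 2 + (2 * u - u ^+ 2 * r)); ring.
(* Modulo [r ^+ k], [p * y * z] is an inverse square root of [s * 'X]; multiplying it by [s * 'X]
   gives a square root. *)
exists e, (s * 'X * (p * y) * z); rewrite ee subrr dvdp0; split=> //.
set w := p * y in rz *; rewrite -/s.
have -> : s * (s * 'X * w * z) ^+ 2 - 'X =
  (s * s) * 'X * (s * 'X * w ^+ 2 * z ^+ 2) - 'X by ring.
rewrite ss; have -> : 1 * 'X * (s * 'X * w ^+ 2 * z ^+ 2) - 'X =
  (- 'X) * (1 - s * 'X * w ^+ 2 * z ^+ 2) by ring.
exact: dvdp_mull.
Qed.

Lemma sqr_up_to_signT q : square_closed_up_to_sign ->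
  coprimep q 'X -> sqr_up_to_sign q.
Proof.
move=> Fcl; have [n] := ubnP (size q).
elim: n q => // n IHn q /ltnSE sz_q co_qX.
have [q_const|q_nconst] := leqP (size q) 1.
  (* A constant coprime to ['X] is nonzero, so it divides everything. *)
  exists 0, 0; rewrite expr0n /= subr0 dvdp0; split=> //.
  apply: dvdp_trans (dvd1p _); move: co_qX.
  rewrite (size1_polyC q_const) coprimepX rootC => c_neq0.
  by apply/dvdpP; exists (q`_0)^-1%:P; rewrite -polyCM mulVf.
have q_neq0 : q != 0 by rewrite -size_poly_gt0 ltnW.
have [r [r_irr rq _ [e [p [ee rp]]]]] := Fcl q q_nconst.
have [k [q' [Dq co lt_q'q]]] := irredp_primary_decomp r_irr q_neq0 rq.
move: co_qX; rewrite Dq coprimepMl coprimep_pexpl // => /andP[co_rX co_q'X].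
apply: sqr_up_to_signM; first exact: coprimep_expl.
  exact: sqr_up_to_sign_primary ee rp.
by apply: IHn => //; apply: leq_trans sz_q.
Qed.

End FieldCond.

(** * Square roots over algebraically closed and real-closed fields *)

Section RealClosed.

Lemma closed_field_root (F : fieldType) : algebraically_closed F ->
  forall q : {poly F}, (1 < size q)%N -> exists x, root q x.
Proof.
move=> Fcl q sz_q.
have q_neq0 : lead_coef q != 0 by rewrite lead_coef_eq0 -size_poly_gt0 ltnW.
have [|x Dx] := Fcl (size q).-1 (fun i => - q`_i / lead_coef q).
  by rewrite -subn1 subn_gt0.
exists x; rewrite /root (@horner_coef_wide _ (size q).-1.+1) ?leqSpred //.
rewrite big_ord_recr /= Dx mulr_sumr -big_split big1 //= => i _.
rewrite mulrA -/(lead_coef q) [lead_coef q * _]mulrCA divff //.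
by rewrite mulr1 mulNr subrr.
Qed.

Lemma closed_field_sqr (F : fieldType) : algebraically_closed F ->
  forall a : F, exists b, b ^+ 2 = a.
Proof.
move=> Fcl a; have [|b] := @closed_field_root F Fcl ('X^2 - a%:P).
  by rewrite size_XnsubC.
by rewrite /root !hornerE subr_eq0 => /eqP; exists b.
Qed.

Lemma closed_field_square_closed (F : fieldType) : algebraically_closed F ->
  square_closed_up_to_sign F.
Proof.
move=> Fcl q /(closed_field_root Fcl)[a qa]; exists ('X - a%:P).
have [b Db] := closed_field_sqr Fcl a.
split; [exact: irredp_XsubC | by rewrite dvdp_XsubCl | by left; exists a|].
exists 0, b%:P; rewrite expr0n; split=> //.
by rewrite mulr0 subr0 mul1r -polyC_exp Db.
Qed.

Lemma Fadjoin_sqrtN1_decomp (F : fieldType) (L : fieldExtType F) (i x : L) :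
    i ^+ 2 = -1 -> x \in <<1; i>>%VS ->
  exists a b, x = in_alg L a + in_alg L b * i.
Proof.
move=> ii /Fadjoin_polyP[p /polyOverP p1 ->].
rewrite horner_coef; elim/big_ind: _ => [|y z [a1 [b1 ->]] [a2 [b2 ->]]|j _].
- by exists 0, 0; rewrite rmorph0 mul0r addr0.
- by exists (a1 + a2), (b1 + b2); rewrite !rmorphD; ring.
have /vlineP[c ->] := p1 j.
have [a [b ->]] : exists a b, i ^+ j = in_alg L a + in_alg L b * i.
  elim: (nat_of_ord j) => [|n [a [b IHn]]].
    by exists 1, 0; rewrite rmorph1 rmorph0 mul0r addr0.
  exists (- b), a; rewrite exprS IHn mulrDr mulrCA -expr2 ii rmorphN; ring.
exists (c * a), (c * b); have -> : c *: 1 = in_alg L c by []; ring.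
Qed.

Section Extension.
Variables (F L : fieldType) (io : {rmorphism F -> L}) (i : L).
Hypothesis two_neq0 : 2 != 0 :> F.
Hypothesis Fncl : ~ algebraically_closed F.
Hypothesis ii : i ^+ 2 = -1.
Hypothesis ext_i_decomp : forall x, exists a b, x = io a + io b * i.
Hypothesis Lcl : algebraically_closed L.

(** A square root of -1 in [F] would put [i], hence all of [L], in the image of [F], and [F] would
    be algebraically closed. *)
Lemma neg1_nonsqr (c : F) : c ^+ 2 != -1.
Proof.
apply/eqP => cc; apply: Fncl => n P n_gt0.
have [x Dx] := Lcl (io \o P) n_gt0.
have [d Dd] : exists d : F, i = io d.
  have : (i - io c) * (i + io c) = 0.
    have -> : (i - io c) * (i + io c) = i ^+ 2 - io (c ^+ 2) by ring.
    by rewrite ii cc rmorphN1 subrr.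
  move/eqP; rewrite mulf_eq0 subr_eq0 addr_eq0 => /orP[]/eqP->.
    by exists c.
  by exists (- c); rewrite rmorphN.
have [a [b]] := ext_i_decomp x; rewrite Dd -rmorphM -rmorphD => Dab.
exists (a + b * d); apply: (fmorph_inj io).
rewrite rmorphXn -Dab Dx rmorph_sum; apply: eq_bigr => k _.
by rewrite rmorphM rmorphXn -Dab.
Qed.

(** If [b] and [d] differed, (c - a)/(b - d) would be a square root of -1 in [F]. *)
Lemma ext_i_eq (a b c d : F) :
  io a + io b * i = io c + io d * i -> a = c /\ b = d.
Proof.
move=> eq_ab; have [Dbd|neq_bd] := eqVneq b d.
  by split=> //; move: eq_ab; rewrite Dbd => /addIr; apply: fmorph_inj.
have /eqP[] := neg1_nonsqr ((c - a) / (b - d)).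
apply: (fmorph_inj io); rewrite rmorphXn fmorph_div rmorphN1 /=.
have neq_bdA : io (b - d) != 0 by rewrite fmorph_eq0 subr_eq0.
have -> : io (c - a) = io (b - d) * i.
  rewrite !rmorphB; transitivity (io c + io d * i - io a - io d * i).
    by ring.
  by rewrite -eq_ab; ring.
by rewrite mulrC mulKf.
Qed.

Lemma ext_i_sqr (a b : F) : exists c d, a = c ^+ 2 - d ^+ 2 /\ b = 2 * c * d.
Proof.
have [y Dy] := closed_field_sqr Lcl (io a + io b * i).
have [c [d Dcd]] := ext_i_decomp y; exists c, d; apply: ext_i_eq.
rewrite -Dy Dcd.
have -> : (io c + io d * i) ^+ 2 =
   io c ^+ 2 + io d ^+ 2 * i ^+ 2 + 2 * io c * io d * i by ring.
rewrite ii; ring.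
Qed.

(** A square root c + d i of [a] in [L] has 2 c d = 0, so it is real or purely imaginary. *)
Lemma sqr_or_opp_sqr (a : F) : exists c, a = c ^+ 2 \/ a = - c ^+ 2.
Proof.
have [c [d [-> /esym/eqP]]] := ext_i_sqr a 0.
rewrite !mulf_eq0 (negPf two_neq0) /= => /orP[]/eqP->.
  by exists d; right; rewrite expr0n sub0r.
by exists c; left; rewrite expr0n subr0.
Qed.

(** A root of [q] in [L] gives a linear factor or an irreducible quadratic one. The residue field is
    then [F], where every element is a square up to sign, or a copy of [L], where every element is a
    square. *)
Lemma real_closed_square_closed : square_closed_up_to_sign F.
Proof.
move=> q sz_q.
have [|l ql] := closed_field_root Lcl (q := map_poly io q).
  by rewrite size_map_poly.
have [a [b Dl]] := ext_i_decomp l.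
have [b0|b_neq0] := eqVneq b 0.
  have qa : root q a.
    by move: ql; rewrite Dl b0 rmorph0 mul0r addr0 fmorph_root.
  exists ('X - a%:P).
  split; [exact: irredp_XsubC | by rewrite dvdp_XsubCl | by left; exists a|].
  have [c [Da|Da]] := sqr_or_opp_sqr a.
    by exists 0, c%:P; rewrite expr0n mulr0 subr0 mul1r -polyC_exp -Da.
  (* Here [a] is minus a square, so the sign -1 is chosen, that is, e = 1. *)
  exists 1, c%:P; rewrite expr1n -polyC_exp; split=> //.
  have -> : (c ^+ 2)%:P = - a%:P by rewrite Da polyCN opprK.
  have -> : (1 - 2 * 1) * 'X - - a%:P = - ('X - a%:P) by ring.
  by rewrite dvdpNr.
(* The factor [r] below is the product of X - l and its conjugate; modulo [r], [j] is a square root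
   of -1 and ['X] is a + b j. *)
set j := b^-1%:P * ('X - a%:P).
have bj : b%:P * j = 'X - a%:P by rewrite mulrA -polyCM divff // mul1r.
pose r := (b ^+ 2)%:P * (j ^+ 2 + 1).
have Dr : r = ('X - a%:P) ^+ 2 + (b ^+ 2)%:P.
  by rewrite -bj /r polyC_exp; ring.
have Mr : size r = 3.
  rewrite Dr size_polyDl size_exp_XsubC // size_polyC.
  by case: (_ != 0).
have rl : root (map_poly io r) l.
  rewrite Dr rmorphD rmorphXn rmorphB /= map_polyX !map_polyC /root !hornerE /=.
  by apply/eqP; rewrite Dl; ring: ii.
have r_nroot x : ~~ root r x.
  rewrite Dr /root !hornerE; apply: contraNneq (neg1_nonsqr ((x - a) / b)).
  by move/(canRL (addrK _)); rewrite sub0r expr_div_n => ->;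
    rewrite mulNr divff ?expf_neq0.
have r_irr : irreducible_poly r by apply: cubic_irreducible; rewrite ?Mr.
have rq : r %| q.
  (* If [r] did not divide [q] they would be coprime, yet both vanish at [l]. *)
  apply/contraT; rewrite -irreducible_poly_coprime // -(coprimep_map io).
  by move/coprimep_root/(_ rl); rewrite -rootE ql.
have rj : r %| j ^+ 2 + 1.
  by apply/dvdpP; exists (b ^+ 2)^-1%:P;
    rewrite mulrA -polyCM mulVf ?mul1r ?expf_neq0.
have [c [d [Da Db]]] := ext_i_sqr a b.
exists r; split => //; first by right; exists j.
exists 0, (c%:P + d%:P * j); rewrite expr0n mulr0 subr0 mul1r; split=> //.
have -> : 'X = a%:P + b%:P * j by rewrite bj; ring.
rewrite Da Db.
have -> : (c ^+ 2 - d ^+ 2)%:P + (2 * c * d)%:P * j - (c%:P + d%:P * j) ^+ 2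
  = - d%:P ^+ 2 * (j ^+ 2 + 1) by ring.
exact: dvdp_mull.
Qed.

End Extension.
End RealClosed.

(** * Traces and determinants of matrices *)

(** With a full-rank factorisation M = C R, the trace of M is that of R C, whose nilpotency exponent
    is smaller by one: C (R C)^k R = M^(k+1) = 0, and C and R can be cancelled. *)
Lemma mxtrace_nilp (F : fieldType) n (M : 'M[F]_n) k : M ^+ k = 0 -> \tr M = 0.
Proof.
elim: k n M => [|k IHk] n M.
  by rewrite expr0 => M1; rewrite -[M]mulr1 M1 mulr0 mxtrace0.
set C := col_base M; set R := row_base M; have CRM : C *m R = M := mulmx_base M.
rewrite -CRM mxtrace_mulC => CR0; apply: IHk.
have CRE j : (C *m R) ^+ j.+1 = C *m (R *m C) ^+ j *m R.
  elim: j => [|j IHj]; first by rewrite expr1 expr0 mulmx1.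
  by rewrite exprS IHj exprS -!mulmxE !mulmxA.
apply: (row_free_inj (row_base_free M)); rewrite mul0mx.
apply: (row_full_inj (col_base_full M)); rewrite mulmx0 mulmxA.
by rewrite -CRE.
Qed.

(** Two block-triangular factorisations of the same matrix are compared. *)
Lemma det_sub_mulmx (F : comNzRingType) n (C : 'cV[F]_n) (U : 'rV[F]_n) :
  \det (1%:M - C *m U) = 1 - (U *m C) 0 0.
Proof.
pose simp := (mul1mx, mulmx1, mul0mx, mulmx0, addr0, add0r).
have DlU : block_mx 1%:M U C 1%:M =
    block_mx 1%:M 0 C 1%:M *m block_mx 1%:M U 0 (1%:M - C *m U).
  by rewrite mulmx_block !simp addrC subrK.
have DUl : block_mx 1%:M U C 1%:M =
    block_mx (1%:M - U *m C) U 0 1%:M *m block_mx 1%:M 0 C 1%:M.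
  by rewrite mulmx_block !simp subrK.
have := congr1 determinant DlU.
rewrite {1}DUl !det_mulmx !det_lblock !det_ublock.
by rewrite !det1 !mul1r !mulr1 det_mx11 !mxE => <-.
Qed.

(** * The regular representation *)

Section Regular.
Variables (F : fieldType) (n : nat) (B : algType F).
Variables (co : {linear B -> 'rV[F]_n.+1}) (rho : {linear 'rV[F]_n.+1 -> B}).
Hypotheses (coK : cancel co rho) (rhoK : cancel rho co).
Implicit Types x y : B.

(** Vectors are rows, so [lmx] reverses products while [rmx] preserves them. *)
Definition lmx x : 'M_n.+1 := \matrix_i co (x * rho (delta_mx 0 i)).
Definition rmx x : 'M_n.+1 := \matrix_i co (rho (delta_mx 0 i) * x).

Lemma mul_lmx v x : v *m lmx x = co (x * rho v).
Proof.
rewrite mulmx_sum_row [in RHS](row_sum_delta v) !linear_sum mulr_sumr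
  linear_sum.
by apply: eq_bigr => i _; rewrite rowK !linearZ /= -scalerAr linearZ.
Qed.

Lemma mul_rmx v x : v *m rmx x = co (rho v * x).
Proof.
rewrite mulmx_sum_row [in RHS](row_sum_delta v) !linear_sum mulr_suml
  linear_sum.
by apply: eq_bigr => i _; rewrite rowK !linearZ /= -scalerAl linearZ.
Qed.

Lemma mulmx_ext m (M N : 'M[F]_(m, n.+1)) :
  (forall v : 'rV_m, v *m M = v *m N) -> M = N.
Proof. by move=> eqMN; apply/row_matrixP => i; rewrite !rowE. Qed.

Lemma lmxM x y : lmx (x * y) = lmx y *m lmx x.
Proof. by apply: mulmx_ext => v; rewrite mulmxA !mul_lmx coK mulrA. Qed.

Lemma rmxM x y : rmx (x * y) = rmx x *m rmx y.
Proof. by apply: mulmx_ext => v; rewrite mulmxA !mul_rmx coK mulrA. Qed.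

Lemma lmx1 : lmx 1 = 1%:M.
Proof. by apply: mulmx_ext => v; rewrite mul_lmx mul1r rhoK mulmx1. Qed.

Lemma lmx_rmxC x y : lmx x *m rmx y = rmx y *m lmx x.
Proof.
by apply: mulmx_ext => v; rewrite !mulmxA !(mul_lmx, mul_rmx) !coK mulrA.
Qed.

Fact lmx_is_linear : linear lmx.
Proof.
move=> a x y; apply: mulmx_ext => v.
by rewrite mulmxDr -scalemxAr !mul_lmx mulrDl linearD -scalerAl linearZ.
Qed.
HB.instance Definition _ := GRing.isLinear.Build F B _ _ lmx lmx_is_linear.

Lemma lmx_inj : injective lmx.
Proof.
move=> x y eq_xy; apply: (can_inj coK); rewrite -[x]mulr1 -[y]mulr1 -[1]coK.
by rewrite -!mul_lmx eq_xy.
Qed.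

Lemma lmx_horner x q : lmx (horner_alg x q) = horner_mx (lmx x) q.
Proof.
elim/poly_ind: q => [|q a IHq]; first by rewrite !rmorph0 raddf0.
rewrite !rmorphD !rmorphM /= horner_algX horner_algC horner_mx_X horner_mx_C.
rewrite linearD /= lmxM IHq linearZ /= lmx1 scalemx1; congr (_ + _).
exact: (comm_mx_horner _ (erefl _)).
Qed.

Lemma char_poly_lmx x : horner_alg x (char_poly (lmx x)) = 0.
Proof.
by apply: lmx_inj; rewrite lmx_horner Cayley_Hamilton raddf0.
Qed.

Definition reg_tr x := \tr (lmx x).

Lemma reg_trC x y : reg_tr (x * y) = reg_tr (y * x).
Proof. by rewrite /reg_tr !lmxM mxtrace_mulC. Qed.

Lemma reg_tr_nilp x k : x ^+ k = 0 -> reg_tr x = 0.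
Proof.
move=> xk0; apply: (@mxtrace_nilp _ _ _ k).
have <- : lmx (x ^+ k) = lmx x ^+ k.
  by elim: {xk0} k => [|j IHj]; rewrite ?lmx1 // exprSr lmxM IHj exprS.
by rewrite xk0 raddf0.
Qed.

(** Invertibility of [x] makes the characteristic polynomial of [lmx x] coprime to ['X]; by
    Cayley-Hamilton the congruences modulo it hold at [x]. *)
Lemma unit_sqr_up_to_sign x y : 2 != 0 :> F -> square_closed_up_to_sign F ->
  x * y = 1 -> exists e p, e * e = e /\ x = (1 - 2 * e) * p ^+ 2.
Proof.
move=> two_neq0 Fcl xy1.
have : coprimep (char_poly (lmx x)) 'X.
  rewrite coprimepX /root horner_coef0 char_poly_det.
  rewrite mulf_neq0 ?signr_eq0 // -unitfE -unitmxE.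
  by have /mulmx1_unit[] : lmx y *m lmx x = 1%:M by rewrite -lmxM xy1 lmx1.
case/(sqr_up_to_signT two_neq0 Fcl) => e [p [qe qp]].
have ev0 r : char_poly (lmx x) %| r -> horner_alg x r = 0.
  by case/dvdpP => s ->; rewrite rmorphM /= char_poly_lmx mulr0.
exists (horner_alg x e), (horner_alg x p); split.
  by apply/subr0_eq; have := ev0 _ qe; rewrite expr2 rmorphB rmorphM.
apply/esym/subr0_eq; have := ev0 _ qp.
rewrite rmorphB rmorphM rmorphXn rmorphB rmorphM rmorph_nat rmorph1 /=.
by rewrite horner_algX.
Qed.

End Regular.

Lemma comm_horner_alg (F : fieldType) (B : algType F) (x y : B) (q : {poly F}) :
  GRing.comm y x -> GRing.comm y (horner_alg x q).
Proof.
move=> xy; elim/poly_ind: q => [|q a IHq].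
  by rewrite rmorph0; apply: commr0.
rewrite rmorphD rmorphM /= horner_algX horner_algC; apply: commrD.
  exact: commrM.
by rewrite /GRing.comm -scalerAl -scalerAr mul1r mulr1.
Qed.

(** * Idempotents and square roots of -1 in corner rings *)

Section Idempotents.
Variables (B : nzRingType).
Implicit Types e f g x y J : B.

Definition subidem f e := [/\ f * f = f, e * f = f & f * e = f].

(* -e is a square in the corner ring e B e. *)
Definition imaginary e := exists J, [/\ e * J = J, J * e = J & J * J = - e].

Definition anisotropic e := forall f, subidem f e -> imaginary f -> f = 0.

(** Zero satisfies this too, so [e != 0] is stated separately where it matters. *)
Definition primitive e := forall f, subidem f e -> f = 0 \/ f = e.

Lemma subidem_trans f e g : subidem f e -> subidem e g -> subidem f g.
Proof.
move=> [ff ef fe] [ee ge eg]; split=> //; first by rewrite -ef mulrA ge.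
by rewrite -fe -mulrA eg.
Qed.

Lemma subidemB f e : e * e = e -> subidem f e -> subidem (e - f) e.
Proof.
move=> ee [ff ef fe]; split; rewrite ?mulrBl ?mulrBr ?ee ?ef ?fe ?ff //.
by rewrite subrr subr0.
Qed.

Lemma subidem_orth f e : subidem f e -> (f * (e - f) = 0) * ((e - f) * f = 0).
Proof. by move=> [ff ef fe]; rewrite mulrBl mulrBr ef fe ff !subrr. Qed.

Lemma imaginaryD f g : f * g = 0 -> g * f = 0 ->
  imaginary f -> imaginary g -> imaginary (f + g).
Proof.
move=> fg gf [I [fI If II]] [J [gJ Jg JJ]].
have IJ : I * J = 0 by rewrite -If -gJ mulrA -(mulrA I) fg mulr0 mul0r.
have JI : J * I = 0 by rewrite -Jg -fI mulrA -(mulrA J) gf mulr0 mul0r.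
have fJ : f * J = 0 by rewrite -gJ mulrA fg mul0r.
have Jf : J * f = 0 by rewrite -Jg -mulrA gf mulr0.
have gI : g * I = 0 by rewrite -fI mulrA gf mul0r.
have Ig : I * g = 0 by rewrite -If -mulrA fg mulr0.
exists (I + J); rewrite !mulrDl !mulrDr fI fJ gI gJ If Ig Jf Jg II IJ JI JJ.
by rewrite !addr0 !add0r opprD.
Qed.

Lemma imaginary0 : imaginary 0.
Proof. by exists 0; rewrite !mulr0 oppr0. Qed.

Lemma imaginary_sqr e : e * e = e -> imaginary e ->
  exists u, 1 - 2 * e = u * u.
Proof.
move=> ee [J [eJ Je JJ]]; exists (1 - e + J).
set d := 1 - e.
have dJ : d * J = 0 by rewrite mulrBl mul1r eJ subrr.
have Jd : J * d = 0 by rewrite mulrBr mulr1 Je subrr.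
have dd : d * d = d by rewrite {2}/d mulrBr mulr1 mulrBl mul1r ee subrr subr0.
have -> : 1 - 2 * e = d - e by rewrite mulrDl mul1r opprD addrA.
by clearbody d; rewrite mulrDl !mulrDr dJ Jd JJ dd addr0 add0r.
Qed.

Lemma mulr_reflection f g : f * g = 0 ->
  (1 - 2 * f) * (1 - 2 * g) = 1 - 2 * (f + g).
Proof.
move=> fg; rewrite mulrBl mul1r mulrBr mulr1 !mulr_natl mulrnAl mulrnAr fg.
by rewrite !mul0rn subr0 mulrnDl (opprD (f *+ 2)) addrA addrAC.
Qed.

Lemma reflection_involutive e : e * e = e -> (1 - 2 * e) * (1 - 2 * e) = 1.
Proof.
move=> ee; have EE : 2 * e * (2 * e) = 2 * e + 2 * e.
  by rewrite !mulr_natl mulrnAl mulrnAr ee -mulr2n.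
by rewrite mulrBl mul1r mulrBr mulr1 EE opprB addrK subrK.
Qed.

(* In the matrix units of the block spanned by a, b, ab and ba, J is the
   rotation [[0, -1], [1, 0]]. *)
Lemma imaginary_block e g a b : e * e = e -> e * g = 0 -> g * e = 0 ->
    g * a = a -> a * e = a -> e * b = b -> b * g = b -> b * a = e ->
  subidem (e + a * b) (g + e) /\ imaginary (e + a * b).
Proof.
move=> ee eg ge ga ae eb bg ba.
have ea : e * a = 0 by rewrite -ga mulrA eg mul0r.
have be : b * e = 0 by rewrite -bg -mulrA ge mulr0.
have aa : a * a = 0 by rewrite -{1}ae -{2}ga mulrA -(mulrA a) eg mulr0 mul0r.
have bb : b * b = 0 by rewrite -{1}bg -{2}eb mulrA -(mulrA b) ge mulr0 mul0r.
have eab : e * (a * b) = 0 by rewrite mulrA ea mul0r.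
have abe : a * b * e = 0 by rewrite -mulrA be mulr0.
have aba : a * b * a = a by rewrite -mulrA ba.
have bab : b * (a * b) = b by rewrite mulrA ba.
have abb : a * b * b = 0 by rewrite -mulrA bb mulr0.
have aab : a * (a * b) = 0 by rewrite mulrA aa mul0r.
split.
  have gab : g * (a * b) = a * b by rewrite mulrA ga.
  have abg : a * b * g = a * b by rewrite -mulrA bg.
  split; rewrite !mulrDl !mulrDr ?ee ?eg ?ge ?eab ?abe ?gab ?abg ?add0r
    ?addr0 //.
  - by rewrite mulrA aba.
  - exact: addrC.
exists (a - b); split.
- by rewrite !mulrDl !mulrDr !mulrN ea eb aba abb sub0r oppr0 addr0 addrC.
- by rewrite !mulrDl !mulrDr !mulNr ae aab be bab oppr0 addr0 add0r.
rewrite !mulrDl !mulrDr !mulrN !mulNr aa bb ba opprK addr0 add0r opprD.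
exact: addrC.
Qed.

End Idempotents.

(** * Corners of a finite-dimensional algebra *)

Section Corner.
Variables (F : fieldType) (n : nat) (B : algType F).
Variables (co : {linear B -> 'rV[F]_n.+1}) (rho : {linear 'rV[F]_n.+1 -> B}).
Hypotheses (coK : cancel co rho) (rhoK : cancel rho co).
Hypothesis two_neq0 : 2 != 0 :> F.
Hypothesis Fcl : square_closed_up_to_sign F.
Implicit Types e f g x y : B.
Local Notation lmx := (lmx co rho).
Local Notation rmx := (rmx co rho).
Local Notation reg_tr := (reg_tr co rho).

(** The ranks are the dimensions of the right ideals (e - f) B and e B. Equality would put e in (e -
    f) B, which left multiplication by f kills, whence f = f e = 0. This drop drives the next two
    inductions. *)
Lemma rank_subidem e f : e * e = e -> subidem f e -> f != 0 ->
  (\rank (lmx (e - f)) < \rank (lmx e))%N.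
Proof.
move=> ee fe f_neq0; have [ff ef fe'] := fe.
have sub : (lmx (e - f) <= lmx e)%MS.
  have -> : e - f = e * (e - f) by rewrite mulrBr ee ef.
  by rewrite lmxM // submxMl.
rewrite ltn_neqAle mxrankS // andbT (mxrank_leqif_sup sub).
apply: contra f_neq0 => /submxP[M DM]; apply/eqP/(lmx_inj coK).
rewrite raddf0 -fe' lmxM // DM -mulmxA -lmxM //.
by rewrite (subidem_orth fe) raddf0 mulmx0.
Qed.

(** Nonzero imaginary subidempotents are split off one by one; being orthogonal, they add up to an
    imaginary idempotent. *)
Lemma imaginary_decomp e : e * e = e ->
  exists f, [/\ subidem f e, imaginary f & anisotropic (e - f)].
Proof.
have [m] := ubnP (\rank (lmx e)); elim: m e => // m IHm e /ltnSE le_m ee.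
have [e_an|e_nan] := classic (anisotropic e).
  exists 0; rewrite subr0; split=> //; last exact: imaginary0.
  by split; rewrite ?mulr0 ?mul0r.
have [f' nf'] := not_all_ex_not _ _ e_nan.
have [f'e nf'e] := imply_to_and _ _ nf'.
have [f'_im /eqP f'_neq0] := imply_to_and _ _ nf'e.
have [f1f f1e] := (subidemB ee f'e, subidemB ee f'e).
have [||f [fe1 f_im f_an]] := IHm (e - f').
- exact: leq_trans (rank_subidem ee f'e f'_neq0) le_m.
- by case: f1e.
have fe := subidem_trans fe1 f1e.
have f'f : f' * f = 0.
  by case: fe1 => _ <- _; rewrite mulrA (subidem_orth f'e) mul0r.
have ff' : f * f' = 0.
  by case: fe1 => _ _ <-; rewrite -mulrA (subidem_orth f'e) mulr0.
exists (f' + f); split.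
- case: f'e fe => [f'f' ef' f'e] [ff ef fe].
  by split; rewrite !(mulrDr, mulrDl) ?f'f' ?ff ?f'f ?ff' ?ef ?ef' ?fe ?f'e
    ?addr0 ?add0r.
- exact: imaginaryD.
by rewrite opprD addrA.
Qed.

Lemma primitive_exists e : e * e = e -> e != 0 ->
  exists f, [/\ subidem f e, f != 0 & primitive f].
Proof.
have [m] := ubnP (\rank (lmx e)); elim: m e => // m IHm e /ltnSE le_m ee e_neq0.
have [e_pr|e_npr] := classic (primitive e); first by exists e.
have [f nf] := not_all_ex_not _ _ e_npr.
have [fe /not_or_and[/eqP f_neq0 /eqP f_neq_e]] := imply_to_and _ _ nf.
have [||f' [f'f f'_neq0 f'_pr]] := IHm f _ _ f_neq0.
(* The rank drop is applied to f = e - (e - f). *)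
- apply: leq_trans le_m; rewrite -[f](subKr e).
  apply: rank_subidem => //; first exact: subidemB.
  by rewrite subr_eq0 eq_sym.
- by case: fe.
by exists f'; split=> //; apply: subidem_trans fe.
Qed.

(** A polynomial killing [x] in the corner is reduced, by primitivity of [e], to a power of one
    irreducible [r]. A linear [r] gives the claim; otherwise a square root of -1 modulo [r] lifts to
    the corner. *)
Lemma primitive_corner e x : e != 0 -> e * e = e -> primitive e ->
    ~ imaginary e -> e * x = x -> x * e = x ->
  exists a k, (x - a *: e) ^+ k = 0.
Proof.
move=> e_neq0 ee e_pr e_nim ex xe.
(* Evaluation at [x] in the corner ring, whose unit is [e]. *)
pose phi q := e * horner_alg x q.
have e_comm q : e * horner_alg x q = horner_alg x q * e.
  by apply: comm_horner_alg; rewrite /GRing.comm ex xe.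
have phiM p q : phi (p * q) = phi p * phi q.
  by rewrite /phi rmorphM [RHS]mulrA -(mulrA e) -e_comm !mulrA ee.
have phiD p q : phi (p + q) = phi p + phi q by rewrite /phi rmorphD mulrDr.
have phiC a : phi a%:P = a *: e.
  by rewrite /phi /= horner_algC -scalerAr mulr1.
have phi1 : phi 1 = e by rewrite phiC scale1r.
have phiX : phi 'X = x by rewrite /phi /= horner_algX.
have phiN p : phi (- p) = - phi p by rewrite /phi rmorphN mulrN.
have phiXn p k : phi (p ^+ k.+1) = phi p ^+ k.+1.
  by elim: k => // k IHk; rewrite exprS phiM IHk -exprS.
have phi_e q : (e * phi q = phi q) * (phi q * e = phi q).
  by rewrite /phi -mulrA -e_comm !mulrA ee.
have : exists q, q != 0 /\ phi q = 0.
  exists (char_poly (lmx x)); rewrite monic_neq0 ?char_poly_monic //.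
  by rewrite /phi char_poly_lmx ?mulr0.
case=> q; have [m] := ubnP (size q).
elim: m q => // m IHm q /ltnSE le_m [q_neq0 phi_q].
have [q_const|q_nconst] := leqP (size q) 1.
  case/eqP: e_neq0; move: q_neq0 phi_q; rewrite (size1_polyC q_const) phiC.
  by rewrite polyC_eq0 => q0 /eqP; rewrite scaler_eq0 (negPf q0) => /eqP.
have [r [r_irr rq r_lin _]] := Fcl q_nconst.
have [k [q' [Dq co_rq' lt_q'q]]] := irredp_primary_decomp r_irr q_neq0 rq.
have /Bezout_eq1_coprimepP[[u v] /= uv] : coprimep (r ^+ k.+1) q'.
  exact: coprimep_expl.
(* As [v * q'] is 1 modulo the power of [r] and 0 modulo [q'], [f] projects onto the [r]-primary
   component. *)
pose f := phi (v * q').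
have uvE : phi (u * r ^+ k.+1) = e - f.
  by rewrite -phi1 -uv phiD -/f addrK.
have phi0 p : q %| p -> phi p = 0.
  by case/dvdpP => s ->; rewrite phiM phi_q mulr0.
have f_sub : subidem f e.
  split; rewrite ?phi_e //; apply/eqP.
  have fe : f * e = f by rewrite phi_e.
  rewrite eq_sym -subr_eq0 -[X in X - _]fe -mulrBr -uvE -phiM phi0 //.
  by rewrite Dq; apply/dvdpP; exists (u * v); ring.
have [f0|f_eq_e] := e_pr f f_sub.
  apply: (IHm q'); first exact: leq_trans le_m.
  split.
    by apply: contraNneq q_neq0 => q'0; rewrite Dq q'0 mulr0.
  rewrite -(phi_e q').1 -[e]subr0 -f0 -uvE -phiM phi0 // Dq.
  by apply/dvdpP; exists u; ring.
have phi_r p : r ^+ k.+1 %| p -> phi p = 0.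
  case/dvdpP => s ->; rewrite -(phi_e _).2 -f_eq_e -phiM phi0 //.
  by rewrite Dq; apply/dvdpP; exists (s * v); ring.
case: r_lin => [[a Dr]|[j rj]].
  by exists a, k.+1; rewrite -phiX -phiC -phiN -phiD -Dr -phiXn phi_r.
case: e_nim.
(* As -j^2 is 1 modulo [r], lifting gives [z] with (j z)^2 = -1 modulo the power of [r]. *)
have [|z rz] := @hensel_inv_sqr _ two_neq0 r (- j ^+ 2) k.+1.
  by rewrite opprK addrC.
exists (phi (j * z)); rewrite !phi_e; split=> //.
apply/eqP; rewrite -addr_eq0 -phi1 -phiM -phiD -(phi_r _ rz); apply/eqP.
by congr phi; ring.
Qed.

Hypothesis reg_tr_nondeg : forall x, (forall y, reg_tr (x * y) = 0) -> x = 0.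

(** The nilpotent part [y] must vanish, since its last nonzero power would lie in the radical of the
    trace form. *)
Lemma primitive_corner_scalar e x : e != 0 -> e * e = e -> primitive e ->
  ~ imaginary e -> exists a, e * x * e = a *: e.
Proof.
move=> e_neq0 ee e_pr e_nim.
have in_corner y : (e * (e * y * e) = e * y * e) * (e * y * e * e = e * y * e).
  by split; [rewrite !mulrA ee | rewrite -[LHS]mulrA ee].
have [|a nil_xa] := primitive_corner e_neq0 ee e_pr e_nim (in_corner x).1.
  by rewrite in_corner.
exists a; set y := _ - _ in nil_xa; apply/subr0_eq; rewrite -/y.
have [ey ye] : e * y = y /\ y * e = y.
  by rewrite mulrBr mulrBl !in_corner -scalerAl -scalerAr ee.
have [//|y_neq0] := eqVneq y 0.
(* The least exponent killing [y] is neither 0 nor 1, hence of the form k + 2. *)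
have /ex_minnP[[|[|k]] /eqP yk0 k_min] : exists k, y ^+ k == 0.
- by case: nil_xa => k yk; exists k; apply/eqP.
- by rewrite expr0 in yk0; have /eqP := oner_neq0 B.
- by rewrite expr1 in yk0.
set z := y ^+ k.+1.
have z_neq0 : z != 0 by apply/negP => /k_min; rewrite ltnn.
have zz : z * z = 0 by rewrite /z -exprD addSnnS exprD yk0 mulr0.
have ez : e * z = z by rewrite /z exprS mulrA ey.
have ze : z * e = z by rewrite /z exprSr -mulrA ye.
(* u = z (e b e) is a scalar plus a nilpotent in the corner and z u = 0, so u is
   nilpotent: z is in the radical of the trace form. *)
case/eqP: (z_neq0); apply: reg_tr_nondeg => b.
have -> : reg_tr (z * b) = reg_tr (z * (e * b * e)).
  by rewrite !mulrA ze [RHS]reg_trC // !mulrA ez.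
set u := _ * _; have [eu ue] : e * u = u /\ u * e = u.
  by split; [rewrite /u mulrA ez | rewrite /u -mulrA in_corner].
have [a' [k' u_nil]] := primitive_corner e_neq0 ee e_pr e_nim eu ue.
have zu : z * u = 0 by rewrite /u mulrA zz mul0r.
have zua j : z * (u - a' *: e) ^+ j = (- a') ^+ j *: z.
  elim: j => [|j IHj]; first by rewrite mulr1 scale1r.
  by rewrite exprSr mulrA IHj -scalerAl mulrBr zu sub0r -scalerAr ze -scaleNr
    scalerA -exprSr.
have /eqP := zua k'; rewrite u_nil mulr0 eq_sym scaler_eq0 (negPf z_neq0) orbF.
rewrite expf_eq0 oppr_eq0 => /andP[_ /eqP a0].
by move: u_nil; rewrite a0 scale0r subr0; apply: reg_tr_nilp.
Qed.

(* Right multiplication by e projects B onto the left ideal B e, so this is the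
   determinant of the left multiplication by x on B e. *)
Definition corner_det e x := \det (lmx x *m rmx e + (1%:M - rmx e)).

Lemma corner_det1 e : corner_det e 1 = 1.
Proof. by rewrite /corner_det lmx1 // mul1mx addrC subrK det1. Qed.

(** [rmx e] is idempotent and commutes with every [lmx], so the cross terms vanish. The factors are
    swapped because [lmx] reverses products. *)
Lemma corner_detM e x y : e * e = e ->
  corner_det e (x * y) = corner_det e x * corner_det e y.
Proof.
move=> ee; rewrite mulrC -det_mulmx; congr (\det _).
have EE : rmx e *m rmx e = rmx e by rewrite -rmxM // ee.
have EC : rmx e *m (1%:M - rmx e) = 0 by rewrite mulmxBr mulmx1 EE subrr.
have CE : (1%:M - rmx e) *m rmx e = 0 by rewrite mulmxBl mul1mx EE subrr.
have CC : (1%:M - rmx e) *m (1%:M - rmx e) = 1%:M - rmx e.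
  by rewrite {1}mulmxBl mul1mx EC subr0.
move: (1%:M - rmx e) EC CE CC => C EC CE CC.
rewrite mulmxDl !mulmxDr CC -(mulmxA _ _ C) EC mulmx0 addr0.
rewrite (lmx_rmxC coK x) (mulmxA C) CE mul0mx add0r mulmxA.
by rewrite -(mulmxA (lmx y)) EE -mulmxA -lmx_rmxC // mulmxA -lmxM.
Qed.

Lemma corner_det_reflection e f :
  corner_det e (1 - 2 * f) = \det (1%:M - 2 *: (lmx f *m rmx e)).
Proof.
rewrite /corner_det linearB /= lmx1 // mulmxBl mul1mx addrC addrA subrK.
by rewrite mulr_natl -scaler_nat linearZ -scalemxAl.
Qed.

(** The matrix P of x -> e x e is a projection onto the line F e; writing it as a column times a row
    gives det(1 - 2P) = 1 - 2. *)
Lemma corner_det_line e : e != 0 -> e * e = e ->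
  (forall x, exists a, e * x * e = a *: e) -> corner_det e (1 - 2 * e) = -1.
Proof.
move=> e_neq0 ee eBe; rewrite corner_det_reflection; set P := _ *m _.
have mulP v : v *m P = co (e * rho v * e).
  by rewrite mulmxA mul_lmx // mul_rmx // coK.
clearbody P; set U := co e; have [j Uj] : exists j, U 0 j != 0.
  apply/existsP; apply: contra_neqT e_neq0; rewrite negb_exists => /forallP U0.
  rewrite -[e]coK -/U -(raddf0 rho); congr (rho _); apply/rowP => j.
  by rewrite mxE; apply/eqP; have := U0 j; rewrite negbK.
pose C := (U 0 j)^-1 *: col j P.
have DP : P = C *m U.
  apply/matrixP => i k; rewrite !mxE big_ord1 !mxE.
  have [a Da] := eBe (rho (delta_mx 0 i)).
  have PE l : P i l = a * U 0 l.
    have := mulP (delta_mx 0 i); rewrite -rowE Da linearZ => /rowP/(_ l).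
    by rewrite !mxE.
  by rewrite !PE mulrCA mulVf // mulr1.
have UC : (U *m C) 0 0 = 1.
  have : U *m C *m U = U by rewrite -mulmxA -DP mulP coK !ee.
  move/rowP/(_ j); rewrite mxE big_ord1 => /(canRL (mulfK Uj)).
  by rewrite divff.
rewrite DP scalemxAl det_sub_mulmx -scalemxAr mxE UC mulr1; ring.
Qed.

(** Being a product of commutators is expressed through multiplicative maps to [F], of which
    [corner_det h] is the instance used. If the anisotropic part [g] of [e] were nonzero, it would
    make -1 a square. *)
Lemma imaginary_of_det e p :
    (forall c : F, c ^+ 2 != -1) -> e * e = e ->
    (forall phi : B -> F, phi 1 = 1 ->
       (forall x y, phi (x * y) = phi x * phi y) ->
       phi ((1 - 2 * e) * p ^+ 2) = 1) ->
  imaginary e.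
Proof.
move=> nsqrN1 ee char1.
have [f [fe f_im g_an]] := imaginary_decomp ee.
set g := e - f in g_an.
have [g0|g_neq0] := eqVneq g 0; first by rewrite -[e](subrK f) -/g g0 add0r.
have [gg eg ge] : subidem g e by exact: subidemB.
have [h [hg h_neq0 h_pr]] := primitive_exists gg g_neq0.
have [hh gh hg'] := hg.
have h_nim : ~ imaginary h by move/(g_an h hg)/eqP; rewrite (negPf h_neq0).
have hBh x := primitive_corner_scalar x h_neq0 hh h_pr h_nim.
set g1 := g - h; have g1_sub : subidem g1 g by exact: subidemB.
have [hg1 g1h] := subidem_orth hg; rewrite -/g1 in hg1 g1h.
have g1Bh x : g1 * x * h = 0.
  set y := _ * h; have [//|y_neq0] := eqVneq y 0.
  have [g1y yh] : g1 * y = y /\ y * h = y.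
    case: g1_sub => g1g1 _ _.
    by split; [rewrite /y !mulrA g1g1 | rewrite /y -mulrA hh].
  (* It suffices that [y] is trace-orthogonal to each [b]. With h (b y) h = a h, the trace is 0 if a
     = 0, while a nonzero [a] yields a block contradicting the anisotropy of [g]. *)
  clearbody y; case/eqP: (y_neq0); apply: reg_tr_nondeg => b.
  have [a Da] := hBh (b * y).
  have [a0|a_neq0] := eqVneq a 0.
    rewrite reg_trC // -[y in b * y]yh mulrA reg_trC //.
    have -> : h * (b * y) = h * (b * y) * h by rewrite -!mulrA yh.
    by rewrite Da a0 scale0r /reg_tr raddf0 mxtrace0.
  (* Scaled so that [b' * y = h]: [y] and [b'] are off-diagonal matrix units. *)
  pose b' := a^-1 *: (h * b * g1).
  have [|||k_sub k_im] := imaginary_block hh hg1 g1h g1y yh (b := b').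
  - by rewrite /b' -scalerAr !mulrA hh.
  - by rewrite /b' -scalerAl -(mulrA _ g1)
      (let: And3 g1g1 _ _ := g1_sub in g1g1).
  - have hby : h * b * y = a *: h by rewrite -Da -!mulrA yh.
    by rewrite /b' -scalerAl -(mulrA (h * b)) g1y hby scalerA mulVf // scale1r.
  rewrite subrK in k_sub; have k0 := g_an _ k_sub k_im.
  (* Multiplying h + y b' = 0 by [h] on the left leaves h = 0, as h g1 = 0. *)
  case/eqP: h_neq0; rewrite -(mulr0 h) -k0 mulrDr hh mulrA -[y in h * y]g1y.
  by rewrite [h * (g1 * y)]mulrA hg1 !mul0r addr0.
have P0 : lmx g1 *m rmx h = 0.
  apply: mulmx_ext => v.
  by rewrite mulmxA mul_lmx // mul_rmx // coK g1Bh raddf0 mulmx0.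
have := char1 _ (corner_det1 h) (fun x y => corner_detM x y hh).
have -> : 1 - 2 * e = (1 - 2 * f) * (1 - 2 * h) * (1 - 2 * g1).
  have [fg gf] := subidem_orth fe; rewrite -/g in fg gf.
  have fh : f * h = 0 by rewrite -gh mulrA fg mul0r.
  have fg1 : f * g1 = 0 by case: g1_sub => _ <- _; rewrite mulrA fg mul0r.
  rewrite mulr_reflection // mulr_reflection; last first.
    by rewrite mulrDl fg1 hg1 addr0.
  by rewrite -addrA [h + _]addrC subrK addrC subrK.
rewrite expr2 !corner_detM // [corner_det h (1 - 2 * g1)]corner_det_reflection.
rewrite P0 scaler0 subr0 det1 mulr1.
have [u ->] := imaginary_sqr (let: And3 ff _ _ := fe in ff) f_im.
have -> : corner_det h (1 - 2 * h) = -1.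
  exact: corner_det_line.
rewrite corner_detM // => /eqP; set d := corner_det h u.
set d' := corner_det h p.
rewrite mulrN1 mulNr => /eqP/(congr1 -%R).
by rewrite opprK => Dd; case/eqP: (nsqrN1 (d * d')); rewrite -Dd; ring.
Qed.

End Corner.

(** * Coefficients in a twisted group algebra *)

Section Twisted.
Variables (F : fieldType) (G : groupType) (tau : G -> G -> F).
Variables (A : algType F) (bar : G -> A).
Hypothesis tgA : is_twisted_group_algebra tau bar.
Implicit Types (a b : A) (x y : G).

Definition bar_coef a : {fsfun G -> F with 0} :=
  proj1_sig (constructive_indefinite_description _ (twist_basis tgA a)).

Lemma bar_coefK a : a = \sum_(x <- finsupp (bar_coef a)) bar_coef a x *: bar x.
Proof.
by case: (proj2_sig
  (constructive_indefinite_description _ (twist_basis tgA a))).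
Qed.

Lemma bar_coef_uniq a (r : {fsfun G -> F with 0}) :
  a = \sum_(x <- finsupp r) r x *: bar x -> bar_coef a = r.
Proof.
case: (proj2_sig
  (constructive_indefinite_description _ (twist_basis tgA a))) => _.
exact.
Qed.

Lemma sum_finsupp (r : {fsfun G -> F with 0}) (s : seq G) :
  uniq s -> {subset finsupp r <= s} ->
  \sum_(x <- s) r x *: bar x = \sum_(x <- finsupp r) r x *: bar x.
Proof.
move=> s_uniq sub; rewrite (bigID (fun x => x \in finsupp r)) /= addrC.
rewrite big1 ?add0r.
  rewrite -big_filter.
  apply/perm_big/uniq_perm; rewrite ?filter_uniq ?fset_uniq //.
  by move=> x; rewrite mem_filter andb_idr // => /sub.
by move=> x xr; rewrite fsfun_dflt // scale0r.
Qed.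

Lemma bar_coef_sum (s : seq G) (f : G -> F) y : uniq s ->
  bar_coef (\sum_(x <- s) f x *: bar x) y = if y \in s then f y else 0.
Proof.
move=> s_uniq.
pose r : {fsfun G -> F with 0} := [fsfun x in seq_fset tt s => f x].
have rE x : r x = if x \in s then f x else 0 by rewrite fsfunE seq_fsetE.
rewrite (@bar_coef_uniq _ r) ?rE // -(@sum_finsupp _ s) // => [|x].
  by apply: eq_big_seq => x xs; rewrite rE xs.
by rewrite mem_finsupp rE; case: ifP; rewrite ?eqxx.
Qed.

Lemma bar_coef_sumE (a : A) (s : seq G) :
  uniq s -> {subset finsupp (bar_coef a) <= s} ->
  a = \sum_(x <- s) bar_coef a x *: bar x.
Proof. by move=> s_uniq sub; rewrite sum_finsupp // -bar_coefK. Qed.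

Lemma bar_coefP k a b y :
  bar_coef (k *: a + b) y = k * bar_coef a y + bar_coef b y.
Proof.
pose s := undup (finsupp (bar_coef a) ++ finsupp (bar_coef b)).
have s_uniq : uniq s by exact: undup_uniq.
have sa : {subset finsupp (bar_coef a) <= s}.
  by move=> x xa; rewrite mem_undup mem_cat xa.
have sb : {subset finsupp (bar_coef b) <= s}.
  by move=> x xb; rewrite mem_undup mem_cat xb orbT.
have -> : k *: a + b = \sum_(x <- s) (k * bar_coef a x + bar_coef b x) *: bar x.
  rewrite [in LHS](bar_coef_sumE s_uniq sa) [in LHS](bar_coef_sumE s_uniq sb).
  rewrite scaler_sumr -big_split; apply: eq_bigr => x _.
  by rewrite scalerA scalerDl.
rewrite bar_coef_sum //; case: ifPn => // ys.
rewrite !fsfun_dflt ?mulr0 ?addr0 //; first by apply: contra ys; apply: sb.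
by apply: contra ys; apply: sa.
Qed.

(** The arguments are exchanged so that a fixed [y] gives a linear form. *)
Definition bar_coefl y a : F := bar_coef a y.
Fact bar_coefl_is_linear y : linear_for *%R (bar_coefl y).
Proof. by move=> k a b; apply: bar_coefP. Qed.
HB.instance Definition _ y :=
  GRing.isLinear.Build F A F *%R (bar_coefl y) (bar_coefl_is_linear y).

Lemma bar_coefl_bar x y : bar_coefl y (bar x) = (x == y)%:R.
Proof.
have -> : bar x = \sum_(z <- [:: x]) 1 *: bar z by rewrite big_seq1 scale1r.
by rewrite /bar_coefl bar_coef_sum // inE eq_sym; case: eqP.
Qed.

Lemma bar_ind (P : A -> Prop) : P 0 ->
  (forall k x b, P b -> P (k *: bar x + b)) -> forall a, P a.
Proof.
move=> P0 PD a; rewrite [a]bar_coefK.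
elim: (X in \sum_(_ <- X) _) => [|x s IHs]; rewrite ?big_nil ?big_cons //.
exact: PD.
Qed.

(** Associativity of [bar 1 * bar 1 * bar x], after cancelling [tau 1 x]. *)
Lemma tau1l x : tau 1%g x = tau 1%g 1%g.
Proof.
have tau_neq0 := twist_neq0 tgA.
have := mulrA (bar 1%g) (bar 1%g) (bar x).
rewrite !(twist_mul tgA) -scalerAr -scalerAl !(twist_mul tgA) !mul1g !scalerA.
move/(congr1 (bar_coefl x)); rewrite !linearZ /= !bar_coefl_bar eqxx !mulr1.
exact: mulIf.
Qed.

Lemma bar1 : bar 1%g = (tau 1%g 1%g)%:A.
Proof.
have lid a : bar 1%g * a = tau 1%g 1%g *: a.
  elim/bar_ind: a => [|k x b IHb]; first by rewrite mulr0 scaler0.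
  rewrite mulrDr scalerDr IHb -scalerAr (twist_mul tgA) mul1g tau1l.
  by rewrite !scalerA mulrC.
by rewrite -[LHS]mulr1 lid.
Qed.

Lemma bar_coefl_mul_bar a x y :
  bar_coefl (x * y)%g (a * bar y) = bar_coefl x a * tau x y.
Proof.
elim/bar_ind: a => [|k z b IHb]; first by rewrite mul0r !raddf0 mul0r.
rewrite mulrDl !linearD /= IHb mulrDl -scalerAl (twist_mul tgA) !linearZ /=.
rewrite !bar_coefl_bar.
congr (_ + _); rewrite (inj_eq (@mulIg _ y)).
by case: eqP => [->|_]; rewrite ?mulr1 // !mulr0 mul0r.
Qed.

End Twisted.

(** * Finite subgroups *)

Record fin_subgroup (G : groupType) := FinSubgroup {
  fs_len : nat;
  fs_elems : fs_len.+1.-tuple G;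
  fs_uniq : uniq fs_elems;
  fs_mul : forall x y,
    x \in fs_elems -> y \in fs_elems -> (x * y)%g \in fs_elems;
  fs_inv : forall x, x \in fs_elems -> (x^-1)%g \in fs_elems
}.

Lemma fs_one (G : groupType) (K : fin_subgroup G) : 1%g \in fs_elems K.
Proof.
have K0 := mem_tnth ord0 (fs_elems K).
by rewrite -(mulgV (tnth (fs_elems K) ord0)) fs_mul ?fs_inv.
Qed.

Lemma fin_subgroup_gen (G : groupType) (s : seq G) : locally_finite G ->
  exists K : fin_subgroup G, {subset s <= fs_elems K}.
Proof.
move=> /(_ s)[t tP]; pose P := generated (fun y => y \in s).
(* The list [t] may exceed the generated subgroup; it is thinned classically to exactly its
   elements, without repetition. *)
have [u [u_uniq uP]] : exists u : seq G,
    uniq u /\ forall x, x \in u <-> x \in t /\ P x.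
  elim: {tP} t => [|x t [u [u_uniq uP]]].
    by exists [::]; split=> // x; split=> // -[].
  have [Px|nPx] := classic (P x); last first.
    exists u; split=> // y; rewrite uP inE; split=> [[-> //]|[]].
      by rewrite orbT.
    by case/predU1P => [->|].
  have [xt|xNt] := boolP (x \in t).
    exists u; split=> // y; rewrite uP inE; split=> [[-> //]|[]].
      by rewrite orbT.
    by case/predU1P => [->|].
  exists (x :: u); split=> [|y].
    by rewrite /= u_uniq andbT; apply: contra xNt => /uP[].
  rewrite !inE; split=> [/predU1P[->|/uP[-> Py]]|[/predU1P[->|yt] Py]].
  - by rewrite eqxx.
  - by rewrite orbT.
  - by rewrite eqxx.
  by apply/orP; right; apply/uP.
have uE x : x \in u <-> P x.
  by rewrite uP; split=> [[]//|Px]; split=> //; apply: tP.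
have u1 : 1%g \in u by apply/uE; apply: generated_1.
have sz_u : size u == (size u).-1.+1 by case: (u) u1.
exists (@FinSubgroup G (size u).-1 (Tuple sz_u) u_uniq
  (fun x y xu yu => (uE _).2 (generated_M ((uE x).1 xu) ((uE y).1 yu)))
  (fun x xu => (uE _).2 (generated_V ((uE x).1 xu)))).
by move=> x xs; apply/uE; apply: generated_mem.
Qed.

(** * The subalgebra spanned by a finite subgroup *)

Section SubgroupAlgebra.
Variables (F : fieldType) (G : groupType) (tau : G -> G -> F).
Variables (A : algType F) (bar : G -> A).
Variables (tgA : is_twisted_group_algebra tau bar) (K : fin_subgroup G).
Local Notation h := (tnth (fs_elems K)).

Definition subgroup_span : {pred A} :=
  fun a => all [in fs_elems K] (finsupp (bar_coef tgA a)).

Lemma subgroup_spanP a :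
  reflect (forall x, bar_coef tgA a x != 0 -> x \in fs_elems K)
          (a \in subgroup_span).
Proof.
apply: (iffP allP) => aK x; first by rewrite -mem_finsupp; apply: aK.
by rewrite mem_finsupp; apply: aK.
Qed.

Fact subgroup_span_submod : GRing.submod_closed subgroup_span.
Proof.
split=> [|k a b /subgroup_spanP aK /subgroup_spanP bK].
  by apply/subgroup_spanP => x; rewrite -/(bar_coefl tgA x 0) raddf0 eqxx.
apply/subgroup_spanP => x; rewrite bar_coefP.
have [->|/aK //] := eqVneq (bar_coef tgA a x) 0.
by rewrite mulr0 add0r; apply: bK.
Qed.

Lemma bar_subgroup_span x : x \in fs_elems K -> bar x \in subgroup_span.
Proof.
move=> xK; apply/subgroup_spanP => y.
rewrite -/(bar_coefl tgA y _) bar_coefl_bar.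
by case: (x =P y) => [<- //|_]; rewrite eqxx.
Qed.

Lemma subgroup_span_ind (P : A -> Prop) : P 0 ->
    (forall k x b, x \in fs_elems K -> P b -> P (k *: bar x + b)) ->
  forall a, a \in subgroup_span -> P a.
Proof.
move=> P0 PD a /allP aK; rewrite [a](bar_coefK tgA).
elim: (finsupp _ : seq G) aK => [|x s IHs] sK; rewrite ?big_nil ?big_cons //.
apply: PD; first by apply: sK; rewrite mem_head.
by apply: IHs => y ys; apply: sK; rewrite inE ys orbT.
Qed.

Fact subgroup_span_subalg : GRing.subalg_closed subgroup_span.
Proof.
have [S0 SD] := subgroup_span_submod; split=> //.
  (* The identity of [A] is [bar 1] divided by [tau 1 1]. *)
  have := SD (tau 1%g 1%g)^-1 (bar 1%g) 0 (bar_subgroup_span (fs_one K)) S0.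
  by rewrite addr0 (bar1 tgA) scalerA mulVf ?scale1r ?(twist_neq0 tgA).
move=> a b aK bK.
elim/subgroup_span_ind: aK => [|k x a' xK IHa]; first by rewrite mul0r.
rewrite mulrDl -scalerAl; apply: (SD) => //.
elim/subgroup_span_ind: bK => [|l y b' yK IHb]; first by rewrite mulr0.
rewrite mulrDr -scalerAr (twist_mul tgA); apply: (SD) => //.
have := SD (tau x y) _ 0 (bar_subgroup_span (fs_mul xK yK)) S0.
by rewrite addr0.
Qed.
HB.instance Definition _ :=
  GRing.isSubalgClosed.Build F A subgroup_span subgroup_span_subalg.

Definition subgroup_algebra := {a : A | a \in subgroup_span}.
HB.instance Definition _ := SubChoice.on subgroup_algebra.
HB.instance Definition _ := [SubChoice_isSubAlgebra of subgroup_algebra by <:].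
Implicit Types b : subgroup_algebra.

Definition in_subgroup_algebra a (aK : a \in subgroup_span) :
    subgroup_algebra :=
  exist (fun a => a \in subgroup_span) a aK.

Definition subgroup_coord b : 'rV[F]_(fs_len K).+1 :=
  \row_i bar_coef tgA (val b) (h i).

Fact subgroup_coord_is_linear : linear subgroup_coord.
Proof. by move=> k b b'; apply/rowP => i; rewrite !mxE linearP bar_coefP. Qed.
HB.instance Definition _ := GRing.isLinear.Build F subgroup_algebra _ _
  subgroup_coord subgroup_coord_is_linear.

Fact subgroup_comb_subproof (v : 'rV[F]_(fs_len K).+1) :
  \sum_i v 0 i *: bar (h i) \in subgroup_span.
Proof.
by apply: rpred_sum => i _; rewrite rpredZ // bar_subgroup_span // mem_tnth.
Qed.

Definition subgroup_comb v : subgroup_algebra :=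
  in_subgroup_algebra (subgroup_comb_subproof v).

Fact subgroup_comb_is_linear : linear subgroup_comb.
Proof.
move=> k u v; apply: val_inj; rewrite linearP /= scaler_sumr -big_split /=.
by apply: eq_bigr => i _; rewrite !mxE scalerA scalerDl.
Qed.
HB.instance Definition _ := GRing.isLinear.Build F _ subgroup_algebra _
  subgroup_comb subgroup_comb_is_linear.

Lemma subgroup_combK : cancel subgroup_comb subgroup_coord.
Proof.
move=> v; apply/rowP => i; rewrite mxE /= -/(bar_coefl _ _ _) linear_sum.
rewrite (bigD1 i) //=.
rewrite linearZ /= bar_coefl_bar eqxx mulr1 big1 ?addr0 // => j ji.
by rewrite linearZ /= bar_coefl_bar (inj_eq (tuple_uniqP _ (fs_uniq K)))
  (negPf ji) mulr0.
Qed.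

Lemma subgroup_coordK : cancel subgroup_coord subgroup_comb.
Proof.
move=> b; apply: val_inj => /=.
have sub : {subset finsupp (bar_coef tgA (val b)) <= fs_elems K}.
  by apply/allP; apply: (valP b).
rewrite [RHS](bar_coef_sumE (fs_uniq K) sub) big_tuple.
by apply: eq_bigr => i _; rewrite mxE.
Qed.

(** The diagonal entry at [h i] is the coefficient of [h i] in b bar(h i), to which only the
    coefficient of [b] at 1 contributes; [tau1l] makes all entries equal. *)
Lemma subgroup_reg_tr b : reg_tr subgroup_coord subgroup_comb b =
  bar_coef tgA (val b) 1%g * tau 1%g 1%g *+ (fs_len K).+1.
Proof.
rewrite -[X in _ *+ X]card_ord -sumr_const; apply: eq_bigr => i _.
rewrite /lmx !mxE /=.
have -> : \sum_j (delta_mx 0 i : 'rV[F]__) 0 j *: bar (h j) = bar (h i).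
  rewrite (bigD1 i) //= big1 ?addr0 => [|j ji];
    rewrite mxE /= ?eqxx ?scale1r //.
  by rewrite (negPf ji) scale0r.
by have := bar_coefl_mul_bar tgA (val b) 1%g (h i); rewrite mul1g (tau1l tgA).
Qed.

(** Pairing with the basis element of the inverse of [h i] reads off the coefficient at [h i], up to
    a factor that is nonzero in characteristic 0. *)
Lemma subgroup_reg_tr_nondeg b : [pchar F] =i pred0 ->
  (forall b', reg_tr subgroup_coord subgroup_comb (b * b') = 0) -> b = 0.
Proof.
move=> charF0 tr0; apply: (can_inj subgroup_coordK); rewrite linear0.
apply/rowP => i; rewrite !mxE.
have hiK := fs_inv (mem_tnth i (fs_elems K)).
have := tr0 (in_subgroup_algebra (bar_subgroup_span hiK)).
rewrite subgroup_reg_tr /= -[X in bar_coef _ _ X](mulgV (h i)).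
rewrite -/(bar_coefl _ _ _) bar_coefl_mul_bar => /eqP.
rewrite -mulr_natr !mulf_eq0 !(negPf (twist_neq0 tgA _ _)) !orbF.
by rewrite ((pcharf0P F).1 charF0) orbF => /eqP.
Qed.

End SubgroupAlgebra.

(** * Products of commutators in finite subalgebras, and the conclusion *)

Lemma algebraically_closed_imaginary (F : fieldType) (B : algType F) (e : B) :
  algebraically_closed F -> e * e = e -> imaginary e.
Proof.
move=> Fcl ee; have [i ii] := closed_field_sqr Fcl (-1).
exists (i *: e); rewrite -!scalerAr -!scalerAl ee; split=> //.
by rewrite scalerA -expr2 ii scaleN1r.
Qed.

Section UnitGroup.
Variables (F : fieldType) (G : groupType) (tau : G -> G -> F).
Variables (A : unitAlgType F) (bar : G -> A).
Variable (tgA : is_twisted_group_algebra tau bar).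

(** Additivity is not asked of [phi]: determinants are the intended instances. *)
Definition character_trivial (K : fin_subgroup G)
    (b : subgroup_algebra tgA K) :=
  forall phi : subgroup_algebra tgA K -> F, phi 1 = 1 ->
    (forall x y, phi (x * y) = phi x * phi y) -> phi b = 1.

(** An element of the derived subgroup involves finitely many units; once [K] contains the supports
    of these and of their inverses, commutativity of [F] forces the value 1. *)
Lemma derived_character_trivial (w : unit_group A) : derived w ->
  exists s : seq G, forall K : fin_subgroup G, {subset s <= fs_elems K} ->
    exists b b' : subgroup_algebra tgA K,
      [/\ val b = val w, val b' = (val w)^-1 & character_trivial b].
Proof.
elim=> [c [x [y ->]]||x y _ [s1 IH1] _ [s2 IH2]|x _ [s IHs]].
(* Supports of inverses are included so that [x] and [y] are units of the subalgebra itself. *)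
- pose s (a : A) : seq G := finsupp (bar_coef tgA a).
  have lift K a : {subset s a <= fs_elems K} ->
      exists b : subgroup_algebra tgA K, val b = a.
    by move=> sub; exists (in_subgroup_algebra (introT allP sub)).
  exists (s (val x) ++ s (val y) ++ s (val x)^-1 ++ s (val y)^-1) => K sK.
  have [|x1 Dx1] := lift K (val x).
    by move=> z zx; rewrite sK // !mem_cat zx.
  have [|y1 Dy1] := lift K (val y).
    by move=> z zx; rewrite sK // !mem_cat zx ?orbT.
  have [|x2 Dx2] := lift K (val x)^-1.
    by move=> z zx; rewrite sK // !mem_cat zx ?orbT.
  have [|y2 Dy2] := lift K (val y)^-1.
    by move=> z zx; rewrite sK // !mem_cat zx ?orbT.
  have xx : x1 * x2 = 1.
    by apply: val_inj; rewrite rmorphM rmorph1 /= Dx1 Dx2 mulrV ?unit_valP.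
  have yy : y1 * y2 = 1.
    by apply: val_inj; rewrite rmorphM rmorph1 /= Dy1 Dy2 mulrV ?unit_valP.
  exists (x1 * y1 * x2 * y2), (y1 * x1 * y2 * x2); split.
  + by rewrite !rmorphM /= Dx1 Dx2 Dy1 Dy2.
  + rewrite !rmorphM /= Dx1 Dx2 Dy1 Dy2.
    rewrite -[RHS]/((val x * val y * (val x)^-1 * (val y)^-1)^-1).
    by rewrite !invrM ?rpredM ?rpredV ?unit_valP // !invrK !mulrA.
  move=> phi phi1 phiM; rewrite !phiM.
  have -> : phi x1 * phi y1 * phi x2 * phi y2 = phi (x1 * x2) * phi (y1 * y2).
    by rewrite !phiM; ring.
  by rewrite xx yy phi1 mulr1.
- exists [::] => K _; exists 1, 1.
  by split=> [||phi phi1 _]; rewrite ?rmorph1 ?invr1.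
- exists (s1 ++ s2) => K sK.
  have [|b1 [b1' [Db1 Db1' b1K]]] := IH1 K.
    by move=> z zs; rewrite sK // mem_cat zs.
  have [|b2 [b2' [Db2 Db2' b2K]]] := IH2 K.
    by move=> z zs; rewrite sK // mem_cat zs orbT.
  exists (b1 * b2), (b2' * b1'); split=> [||phi phi1 phiM].
  + by rewrite rmorphM /= Db1 Db2.
  + by rewrite rmorphM /= Db1' Db2' invrM ?unit_valP.
  by rewrite phiM b1K // b2K // mulr1.
exists s => K sK; have [b [b' [Db Db' bK]]] := IHs K sK.
exists b', b; split=> [||phi phi1 phiM]; rewrite ?Db ?invrK //.
have bb : b * b' = 1.
  by apply: val_inj; rewrite rmorphM rmorph1 /= Db Db' mulrV ?unit_valP.
by have := phiM b b'; rewrite bb phi1 bK // mul1r => <-.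
Qed.

End UnitGroup.

Theorem theorem4p4 (F : fieldType) (G : groupType) (tau : G -> G -> F)
    (A : unitAlgType F) (bar : G -> A)
    (charF0 : [pchar F]%R =i pred0)
    (Gfin : locally_finite G)
    (Atwisted : is_twisted_group_algebra tau bar)
    (Fclosed : algebraically_closed F \/ real_closed F)
    (w : unit_group A) (w_derived : derived w) :
  exists u v : unit_group A, w = (u ^+ 2 * v ^+ 2)%g.
Proof.
have two_neq0 : 2 != 0 :> F by rewrite ((pcharf0P F).1 charF0).
have [Fsc e_im] : square_closed_up_to_sign F /\ (algebraically_closed F \/
    forall c : F, c ^+ 2 != -1).
  case: Fclosed => [Fcl|[Fncl [L [i [ii Li Lcl]]]]].
    by split; [apply: closed_field_square_closed | left].
  have dec x : exists a b, x = in_alg L a + in_alg L b * i.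
    by apply: Fadjoin_sqrtN1_decomp => //; rewrite Li memvf.
  split; first exact: real_closed_square_closed dec Lcl.
  by right; apply: neg1_nonsqr dec Lcl.
have [s sP] := derived_character_trivial Atwisted w_derived.
have [K /sP[b [b' [Db Db' bK]]]] := fin_subgroup_gen s Gfin.
have coK := @subgroup_coordK _ _ _ _ _ Atwisted K.
have rhoK := @subgroup_combK _ _ _ _ _ Atwisted K.
have bb' : b * b' = 1.
  by apply: val_inj; rewrite rmorphM rmorph1 /= Db Db' mulrV ?unit_valP.
have [e [p [ee Dbep]]] := unit_sqr_up_to_sign coK rhoK two_neq0 Fsc bb'.
have [u Du] : exists u, 1 - 2 * e = u * u.
  apply: (imaginary_sqr ee); case: e_im => [Fcl|nsqrN1].
    exact: (algebraically_closed_imaginary Fcl ee).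
  apply: (imaginary_of_det coK rhoK two_neq0 Fsc _ nsqrN1 ee (p := p)).
    by move=> x; apply: subgroup_reg_tr_nondeg.
  by rewrite -Dbep.
(* This makes [u] a unit; [p] is then one because [w] is. *)
have u4 : u ^+ 4 = 1.
  have -> : u ^+ 4 = (u * u) * (u * u) by rewrite -!expr2 -exprM.
  by rewrite -Du reflection_involutive ?mulr1.
have Dw : val w = val u ^+ 2 * val p ^+ 2.
  by rewrite -Db Dbep Du -expr2 rmorphM !rmorphXn.
have u_unit : val u \is a GRing.unit.
  by rewrite -(@unitrX_pos _ _ 4) // -rmorphXn u4 rmorph1 unitr1.
have p_unit : val p \is a GRing.unit.
  rewrite -(@unitrX_pos _ _ 2) //; have := unit_valP w.
  by rewrite [unit_val w]Dw unitrMr //; apply: unitrX.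
by exists (UnitGroup u_unit), (UnitGroup p_unit); apply: val_inj; rewrite Dw.
Qed.
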